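(* Let $G$ be a (finite) complete multipartite graph having at least one part of size 4 or larger. Then $G$ is not dimension-critical.
   Context: All graphs are finite and simple. A graph $G$ is representable (embeddable) in $\mathbb{R}^n$ if its vertices can be placed at distinct points of $\mathbb{R}^n$ so that any two adjacent vertices are at Euclidean distance exactly 1 (non-adjacent vertices are also allowed to be at distance 1). By convention, $\mathbb{R}^0$ is a single point. The dimension $\dim(G)$ is the smallest integer $n \ge 0$ such that $G$ is representable in $\mathbb{R}^n$. A non-empty graph $G$ is dimension-critical if every proper subgraph $H$ of $G$ (not necessarily induced) satisfies $\dim(H) < \dim(G)$. *)

(* Defs.v *)
From mathcomp Require Import all_boot all_order all_algebra.
From mathcomp Require Import boolp reals.

Set Implicit Arguments.
Unset Strict Implicit.
Unset Printing Implicit Defensive.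

Import Order.TTheory GRing.Theory Num.Theory.
Local Open Scope ring_scope.

(* Finite simple graphs whose vertices are drawn from a finite type V. The
   vertex set is a field, rather than all of V, so that a graph and its
   subgraphs have the same type. *)
Record graph (V : finType) := Graph {
  verts : {set V};
  adj : rel V;
  adj_sym : symmetric adj;
  adj_irr : irreflexive adj;
  adj_verts : forall x y, adj x y -> (x \in verts) && (y \in verts)
}.

Definition subgraph (V : finType) (H G : graph V) : Prop :=
  verts H \subset verts G /\ subrel (adj H) (adj G).

Definition proper_subgraph (V : finType) (H G : graph V) : Prop :=
  subgraph H G /\ ~ subgraph G H.

(* The library's norm on 'rV[R]_n is the sup norm. *)
Definition edist (R : realType) (n : nat) (u v : 'rV[R]_n) : R :=
  Num.sqrt (\sum_(i < n) (u ord0 i - v ord0 i) ^+ 2).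

Definition representable (R : realType) (V : finType) (G : graph V)
    (n : nat) : Prop :=
  exists p : V -> 'rV[R]_n,
    {in verts G &, injective p} /\
    (forall x y, adj G x y -> edist (p x) (p y) = 1).

(* Put the vertices at the corners of a regular simplex of side 1. *)
Lemma representable_simplex (R : realType) (V : finType) (G : graph V) :
  representable R G #|V|.
Proof.
pose s : R := (Num.sqrt 2)^-1.
have s2 : s ^+ 2 = 2^-1 by rewrite exprVn sqr_sqrtr // ler0n.
have s0 : s != 0 by rewrite invr_eq0 sqrtr_eq0 -ltNge ltr0n.
exists (fun x => \row_j (s * (j == enum_rank x)%:R)); split.
  move=> x y _ _ /rowP/(_ (enum_rank x)); rewrite !mxE eqxx => /(mulfI s0).
  by case: eqP => [/enum_rank_inj//|_] /eqP; rewrite oner_eq0.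
move=> x y xy; have nxy : enum_rank x != enum_rank y.
  by apply/eqP => /enum_rank_inj exy; rewrite exy adj_irr in xy.
rewrite /edist (bigD1 (enum_rank x)) //= (bigD1 (enum_rank y)) /=; last first.
  by rewrite eq_sym.
rewrite big1 => [|i /andP[/negPf ix /negPf iy]]; last first.
  by rewrite !mxE ix iy subrr expr0n.
rewrite !mxE !eqxx (negPf nxy) eq_sym (negPf nxy).
rewrite !mulr0 !mulr1 subr0 sub0r sqrrN addr0 s2.
by rewrite -[2^-1]mul1r -splitr sqrtr1.
Qed.

Lemma exists_representable (R : realType) (V : finType) (G : graph V) :
  exists n, `[< representable R G n >].
Proof. by exists #|V|; apply/asboolP; exact: representable_simplex. Qed.

Definition dim (R : realType) (V : finType) (G : graph V) : nat :=
  ex_minn (exists_representable R G).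

Definition dimension_critical (R : realType) (V : finType) (G : graph V) :
    Prop :=
  verts G != set0 /\
  (forall H : graph V, proper_subgraph H G -> (dim R H < dim R G)%N).

(* P is the set of parts; partition requires the parts to be nonempty. *)
Definition complete_multipartite (V : finType) (G : graph V)
    (P : {set {set V}}) : Prop :=
  partition P (verts G) /\
  {in verts G &, forall x y, adj G x y = (pblock P x != pblock P y)}.

(* Main.v *)
Require Import Defs.
From mathcomp Require Import all_boot all_order all_algebra.
From mathcomp Require Import boolp reals.
From mathcomp Require Import ring lra.

(* Deleting a vertex v from a part A of size at least 4 leaves three vertices
   a, b, c of A.  In a representation of the smaller graph, a, b, c are at
   distance 1 from all neighbours of v, hence so is every point of the circle
   through a, b, c (of the line ab, if v has no neighbours).  Infinitely many
   positions are thus available for v, and one of them avoids the finitely many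
   points already used, so the deletion did not lower the dimension. *)

Set Implicit Arguments.
Unset Strict Implicit.
Unset Printing Implicit Defensive.

Import Order.TTheory GRing.Theory Num.Theory.

Lemma injective_seq_escape (T : eqType) (f : nat -> T) (s : seq T) :
  injective f -> exists m, f m \notin s.
Proof.
move=> f_inj; apply: contrapT => all_in.
(* Pigeonhole: the first [(size s).+1] terms are distinct, too many to fit in [s]. *)
have sub : {subset [seq f i | i <- iota 0 (size s).+1] <= s}.
  move=> _ /mapP[i _ ->]; apply: contrapT => /negP fi.
  by apply: all_in; exists i.
have := uniq_leq_size _ sub.
by rewrite map_inj_uniq ?iota_uniq // size_map size_iota ltnn => /(_ isT).
Qed.

Section DeleteVertex.
Variables (V : finType) (G : graph V) (v : V).

Definition del_adj : rel V := [rel x y | [&& x != v, y != v & adj G x y]].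

Lemma del_adj_sym : symmetric del_adj.
Proof. by move=> x y; rewrite /del_adj /= adj_sym andbCA. Qed.

Lemma del_adj_irr : irreflexive del_adj.
Proof. by move=> x; rewrite /del_adj /= adj_irr !andbF. Qed.

Lemma del_adj_verts x y :
  del_adj x y -> (x \in verts G :\ v) && (y \in verts G :\ v).
Proof. by case/and3P=> xv yv /adj_verts /andP[xG yG]; rewrite !inE xv yv xG. Qed.

Definition del_vertex : graph V := Graph del_adj_sym del_adj_irr del_adj_verts.

Lemma del_vertex_proper : v \in verts G -> proper_subgraph del_vertex G.
Proof.
move=> vG; split; first by split; [exact: subD1set | move=> x y /and3P[]].
by case=> /subsetP/(_ v vG); rewrite !inE eqxx.
Qed.

End DeleteVertex.

Local Open Scope ring_scope.

Lemma dim_le (R : realType) (V : finType) (G H : graph V) :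
  (forall n, representable R H n -> representable R G n) ->
  (Defs.dim R G <= Defs.dim R H)%N.
Proof.
rewrite /Defs.dim => HG; case: ex_minnP => m _ m_min; case: ex_minnP => k /asboolP Hk _.
by apply/m_min/asboolP/HG.
Qed.

Section Euclidean.
Variables (R : realType) (n : nat).
Implicit Types a b c d q u v w : 'rV[R]_n.

Definition dot u v : R := \sum_(i < n) u ord0 i * v ord0 i.

Lemma dotC u v : dot u v = dot v u.
Proof. by apply: eq_bigr => i _; rewrite mulrC. Qed.

Lemma dotDl u v w : dot (u + v) w = dot u w + dot v w.
Proof. by rewrite -big_split; apply: eq_bigr => i _; rewrite mxE mulrDl. Qed.

Lemma dotDr u v w : dot w (u + v) = dot w u + dot w v.
Proof. by rewrite dotC dotDl !(dotC w). Qed.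

Lemma dotZl k u v : dot (k *: u) v = k * dot u v.
Proof. by rewrite mulr_sumr; apply: eq_bigr => i _; rewrite mxE mulrA. Qed.

Lemma dotZr k u v : dot u (k *: v) = k * dot u v.
Proof. by rewrite dotC dotZl dotC. Qed.

Lemma dot_ge0 u : 0 <= dot u u.
Proof. by apply: sumr_ge0 => i _; rewrite -expr2 sqr_ge0. Qed.

Lemma dot_eq0 u : (dot u u == 0) = (u == 0).
Proof.
apply/idP/eqP => [|->]; last by rewrite /dot big1 // => i _; rewrite mxE mul0r.
rewrite psumr_eq0 => [/allP u0|i _]; last by rewrite -expr2 sqr_ge0.
apply/rowP => i; have := u0 i (mem_index_enum i).
by rewrite mxE -expr2 sqrf_eq0 => /eqP.
Qed.

Lemma dot_gt0 u : (0 < dot u u) = (u != 0).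
Proof. by rewrite lt_def dot_eq0 dot_ge0 andbT. Qed.

(** Squaring removes the root, so distance conditions become polynomial identities in [dot]. *)
Lemma edist_eq1 u v : (edist u v = 1) <-> (dot (u - v) (u - v) = 1).
Proof.
have -> : edist u v = Num.sqrt (dot (u - v) (u - v)).
  by congr Num.sqrt; apply: eq_bigr => i _; rewrite !mxE expr2.
split=> [d1 | ->]; last exact: sqrtr1.
by rewrite -(sqr_sqrtr (dot_ge0 _)) d1 expr1n.
Qed.

Lemma edistC u v : edist u v = edist v u.
Proof. by congr Num.sqrt; apply: eq_bigr => i _; rewrite -sqrrN opprB. Qed.

(** Expand the square of the norm of [(a - q) + d]. In the resulting equation [q] occurs only in a
    term linear in [d], so the equations for two chords combine into one for their linear
    combinations. *)
Lemma unit_sphere_chord q a d :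
  edist a q = 1 ->
  edist (a + d) q = 1 <-> 2 * dot (a - q) d = - dot d d.
Proof.
move=> /edist_eq1 aq; rewrite edist_eq1 (addrAC a).
by rewrite (dotDl (a - q)) !(dotDr (a - q) d) aq (dotC d); split=> h; lra.
Qed.

(* The set of points at distance 1 from all of Q is a sphere of some dimension;
   the sequence runs through its circle [abc], as seen from [a]: the m-th point
   is the second intersection of that circle with the line through [a]
   directed by [m (b - a) + (c - a)]. *)
Lemma equidistant_infinite (Q : 'rV[R]_n -> Prop) a b c :
  a != b -> b != c -> c != a ->
  (forall q, Q q -> [/\ edist a q = 1, edist b q = 1 & edist c q = 1]) ->
  exists f : nat -> 'rV[R]_n,
    injective f /\ forall m q, Q q -> edist (f m) q = 1.
Proof.
move=> ab bc ca Q1; pose u := b - a; pose w := c - a.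
have u0 : u != 0 by rewrite subr_eq0 eq_sym.
have w0 : w != 0 by rewrite subr_eq0.
have [[q0 Qq0]|noQ] := pselect (exists q, Q q); last first.
  exists (fun m => a + m%:R *: u); split=> [m k /addrI /eqP|m q Qq].
    rewrite -subr_eq0 -scalerBl scaler_eq0 (negPf u0) orbF subr_eq0 eqr_nat.
    by move/eqP.
  by case: noQ; exists q.
have chord q : Q q -> 2 * dot (a - q) u = - dot u u /\
                      2 * dot (a - q) w = - dot w w.
  case/Q1=> aq bq cq.
  by split; apply/(unit_sphere_chord _ aq); rewrite addrC subrK.
(* A line meets a sphere in at most two points: if [w = k u], the two chord equations force [k = 0]
   or [k = 1], that is [c = a] or [c = b]. *)
have u_w k : w != k *: u.
  apply/eqP => wku; have [uq] := chord _ Qq0.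
  rewrite wku !dotZr dotZl mulrCA uq => kq.
  have : k * (k - 1) * dot u u = 0 by lra.
  move/eqP; rewrite !mulf_eq0 dot_eq0 (negPf u0) orbF subr_eq0.
  case/orP=> /eqP k0; rewrite k0 in wku.
    by rewrite wku scale0r eqxx in w0.
  by move: wku; rewrite scale1r => /addIr cb; rewrite cb eqxx in bc.
clearbody u w.
pose d m : 'rV[R]_n := m%:R *: u + w.
have d0 m : d m != 0.
  by rewrite /d addrC addr_eq0 -scaleNr u_w.
(* The nonzero solution [l] of [2 (a - q).(l d) = - l^2 d.d]. The chord equations for [u] and [w]
   eliminate [q], so one value serves all of [Q]. *)
pose l m := (m%:R * dot u u + dot w w) / dot (d m) (d m).
have l0 m : l m != 0.
  rewrite mulf_neq0 ?invr_eq0 ?dot_eq0 ?d0 //.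
  by rewrite gt_eqF // ltr_wpDl ?dot_gt0 // mulr_ge0 ?dot_ge0.
exists (fun m => a + l m *: d m); split=> [m k /addrI lmk | m q Qq].
  (* Since [w] is no multiple of [u], equal points have equal coefficients on [w], hence
     [l m = l k]; comparing those on [u] then gives [m = k], as [l] never vanishes. *)
  have lwu : (l m - l k) *: w = (l k * k%:R - l m * m%:R) *: u.
    move: lmk; rewrite /d !scalerDr !scalerA => lmk.
    apply/eqP; rewrite !scalerBl subr_eq addrAC -lmk.
    by rewrite [_ + l m *: w]addrC addrK.
  have [elk|nlk] := eqVneq (l m) (l k).
    move: lwu; rewrite elk subrr scale0r -mulrBr => /esym/eqP.
    rewrite scaler_eq0 (negPf u0) orbF mulf_eq0 (negPf (l0 _)) subr_eq0 eqr_nat.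
    by move/eqP.
  have nz : l m - l k != 0 by rewrite subr_eq0.
  have /eqP := u_w ((l m - l k)^-1 * (l k * k%:R - l m * m%:R)).
  by rewrite -scalerA -lwu scalerA mulVf // scale1r.
have [aq _ _] := Q1 _ Qq; have [uq wq] := chord _ Qq.
apply/(unit_sphere_chord _ aq).
have ld : l m * dot (d m) (d m) = m%:R * dot u u + dot w w.
  by rewrite mulfVK // dot_eq0.
have aqd : 2 * dot (a - q) (d m) = - (m%:R * dot u u + dot w w).
  by rewrite dotDr dotZr mulrDr wq mulrCA uq; ring.
by rewrite dotZr dotZl dotZr ld mulrCA aqd mulrN.
Qed.

End Euclidean.

(** The inclusion of neighbourhoods puts the images of [a], [b], [c] on every unit sphere that must
    contain the new position of [v]. *)
Lemma representable_restore (R : realType) (V : finType) (G : graph V)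
    (v a b c : V) n :
  a != b -> b != c -> c != a ->
  {in [:: a; b; c], forall x, [/\ x != v, x \in verts G &
    forall y, adj G v y -> adj G x y]} ->
  representable R (del_vertex G v) n -> representable R G n.
Proof.
move=> ab bc ca abcP [p [p_inj p_adj]].
have [av aG aP] := abcP a (mem_head _ _).
have [bv bG bP] := abcP b ltac:(by rewrite !inE eqxx orbT).
have [cv cG cP] := abcP c ltac:(by rewrite !inE eqxx !orbT).
have p_neq x y : x != v -> y != v -> x \in verts G -> y \in verts G ->
    x != y -> p x != p y.
  move=> xv yv xG yG; apply: contraNneq => /p_inj -> //.
    by rewrite !inE xv.
  by rewrite !inE yv.
have adj_v x : adj G v x -> x != v.
  by apply: contraTneq => ->; rewrite adj_irr.
pose Q q := exists2 x, adj G v x & q = p x.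
have Q1 q : Q q ->
    [/\ edist (p a) q = 1, edist (p b) q = 1 & edist (p c) q = 1].
  by case=> x vx ->; have xv := adj_v x vx; split; apply: p_adj;
    rewrite /= /del_adj /= ?av ?bv ?cv xv ?aP ?bP ?cP.
have [f [f_inj f1]] := equidistant_infinite (p_neq _ _ av bv aG bG ab)
  (p_neq _ _ bv cv bG cG bc) (p_neq _ _ cv av cG aG ca) Q1.
(* [codom p] also contains the values of [p] at [v] and outside [verts G]; it is finite all the
   same, and avoiding it keeps the placement injective. *)
have [m fm] := injective_seq_escape (codom p) f_inj.
have fm_p x : f m != p x.
  by apply: contraNneq fm => ->; apply: codom_f.
exists (fun x => if x == v then f m else p x); split=> [x y xG yG|x y xy].
  case: eqVneq => [->|xv]; case: eqVneq => [->|yv] //.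
  - by move/eqP; rewrite (negPf (fm_p _)).
  - by move/esym/eqP; rewrite (negPf (fm_p _)).
  - by apply: p_inj; rewrite !inE ?xv ?yv.
case: eqVneq xy => [->|xv]; case: eqVneq => [->|yv] xy.
- by rewrite adj_irr in xy.
- by apply: f1; exists y.
- by rewrite edistC; apply: f1; exists x; rewrite // adj_sym.
- by apply: p_adj; rewrite /= /del_adj /= xv yv.
Qed.

Local Close Scope ring_scope.

Theorem corollary2p2 (R : realType) (V : finType) (G : graph V)
    (P : {set {set V}}) :
  complete_multipartite G P ->
  (exists A : {set V}, A \in P /\ 4 <= #|A|) ->
  ~ dimension_critical R G.
Proof.
move=> [partP adjP] [A [AP A4]] [_ crit].
have [/eqP covP trivP _] := and3P partP.
have [v vA] : exists v, v \in A.
  by apply/card_gt0P; apply: leq_trans A4.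
have /card_gt2P[a [b [c [[aA bA cA] [ab bc ca]]]]] : 2 < #|A :\ v|.
  by have := cardsD1 v A; rewrite vA => e; rewrite e in A4.
have AG x : x \in A -> x \in verts G.
  by move=> xA; rewrite -covP; apply/bigcupP; exists A.
(* Adjacency depends only on the blocks, so vertices of the same part have the same neighbours. *)
have twin x : x \in A :\ v -> [/\ x != v, x \in verts G &
    forall y, adj G v y -> adj G x y].
  case/setD1P=> xv xA; split=> // [|y vy]; first exact: AG.
  have /andP[vG yG] := adj_verts vy.
  rewrite (adjP _ _ (AG x xA) yG) (def_pblock trivP AP xA) -(def_pblock trivP AP vA).
  by rewrite -adjP.
have := crit _ (del_vertex_proper (AG v vA)).
apply/negP; rewrite -leqNgt; apply: dim_le => n.
apply: (representable_restore ab bc ca) => x.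
by rewrite !inE => /or3P[] /eqP ->; apply: twin.
Qed.
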